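(* Assume that $\nabla^2V$ is $\Gamma$-Lipschitz on $U^\nu$. For any $c>1$, $H_{\min}>0$ and $\varepsilon\in(0,\nu)$, there exists $h_0>0$ such that, for every $0<h<h_0$, the sequence $\{x_k\}$ generated by $$x_{k+1}=x_k+hf(x_k)-\beta(x_k)\nabla V(x_k),\qquad \beta(x):=\frac{1}{c\,\max\{\|\nabla^2V(x)\|,H_{\min}\}},$$ from $x_0=x_I\in\Lambda$ satisfies $V(x_k)\le\varepsilon$ for all $k\ge0$.
   Context: Setting. $M$ is a smooth manifold embedded in $\mathbb R^n$, and $\dot x=f(x)$, $x(0)=x_I\in M$, is a dynamical system on $M$ whose solutions on $M$ exist globally and which admits first integrals $f_1,\dots,f_\ell:M\to\mathbb R$. The vector field $f$ and the functions $f_j$ are assumed to extend smoothly to an open neighborhood $U\subset\mathbb R^n$ of $M$ (same symbols for the extensions, so $f:U\to\mathbb R^n$). Put $\Lambda=\{x\in U: x\in M,\ f_j(x)=f_j(x_I),\ j=1,\dots,\ell\}$. $V:U\to\mathbb R_{\ge 0}$ is an analytic function with $V^{-1}(0)=\Lambda$ such that: (A1) $\langle\nabla V(x),f(x)\rangle=0$ for all $x\in U$; (A2) $\nu>0$ is such that $V^{-1}([0,\nu])\subseteq U$ is compact; (A3) all critical points of $V$ in $V^{-1}([0,\nu])$ lie in $V^{-1}(0)$. For $\varepsilon>0$ write $U^\varepsilon:=V^{-1}([0,\varepsilon])$. $\|\cdot\|$ is the matrix 2-norm; ''$\nabla^2V$ is $\Gamma$-Lipschitz on $U^\nu$'' means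 $\|\nabla^2V(x)-\nabla^2V(y)\|\le\Gamma|x-y|$ for all $x,y\in U^\nu$, with $|\cdot|$ the Euclidean norm. The conclusion includes that all iterates are defined, i.e. remain in $U$. *)

(* Defs.v *)
From HB Require Import structures.
From mathcomp Require Import all_boot all_order all_algebra finmap.
From mathcomp Require Import all_classical all_reals all_analysis.
From mathcomp Require showcase.summability.

Set Implicit Arguments.
Unset Strict Implicit.
Unset Printing Implicit Defensive.
Import Order.TTheory GRing.Theory Num.Theory.
Import numFieldNormedType.Exports.
Local Open Scope classical_set_scope.
Local Open Scope ring_scope.

(* Points and vectors of R^n are row vectors.  The library's norm on 'rV[R]_n
   is the sup norm: it is used below only through the topology, open sets,
   compactness and differentiability, which it shares with the Euclidean norm. *)

Section Euclidean.
Context {R : realType} {n : nat}.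
Implicit Types (u v : 'rV[R]_n) (A : 'M[R]_n).

Definition dotv u v : R := \sum_(i < n) u 0 i * v 0 i.

Definition enorm u : R := Num.sqrt (dotv u u).

(* u *m A^T is the row form of the column vector A u. *)
Definition mx2norm A : R :=
  sup [set enorm (u *m A^T) | u in [set u | enorm u <= 1]].

End Euclidean.

Section Calculus.
Context {R : realType} {n : nat}.

Definition partials {W : normedModType R} (s : seq 'I_n)
    (g : 'rV[R]_n -> W) : 'rV[R]_n -> W :=
  foldr (fun i k => 'D_(delta_mx 0 i) k) g s.

(* Only the values of g on the open set U matter: derivatives at a point of U
   are local. *)
Definition smooth_on {W : normedModType R} (U : set 'rV[R]_n)
    (g : 'rV[R]_n -> W) : Prop :=
  forall (s : seq 'I_n) x, U x -> differentiable (partials s g) x.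

Definition grad (g : 'rV[R]_n -> R) (x : 'rV[R]_n) : 'rV[R]_n :=
  \row_(i < n) partials [:: i] g x.

Definition hess (g : 'rV[R]_n -> R) (x : 'rV[R]_n) : 'M[R]_n :=
  \matrix_(i < n, j < n) partials [:: i; j] g x.

Definition multi_index := {ffun 'I_n -> nat}.

Definition mi_seq (a : multi_index) : seq 'I_n :=
  flatten [seq nseq (a i) i | i <- enum 'I_n].

Definition taylor_term (g : 'rV[R]_n -> R) (p x : 'rV[R]_n)
    (a : multi_index) : R :=
  partials (mi_seq a) g p / (\prod_(i < n) (a i)`!)%:R
  * \prod_(i < n) (x - p) 0 i ^+ a i.

(* The Taylor series is summed over the directed set of finite sets of
   multi-indices, i.e. unconditionally (equivalently, absolutely). *)
Definition analytic_on (U : set 'rV[R]_n) (g : 'rV[R]_n -> R) : Prop :=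
  smooth_on U g /\
  forall p, U p -> \forall x \near p,
    summability.partial_sum (taylor_term g p x) @ summability.totally --> g x.

End Calculus.

Section DynamicalSystem.
Context {R : realType} {n : nat}.
Implicit Types (M : set 'rV[R]_n) (f : 'rV[R]_n -> 'rV[R]_n).

(* Local slice charts: phi : W -> W' is a diffeomorphism of open sets, with
   inverse psi, which straightens M into R^d x {0}. *)
Definition embedded_manifold M : Prop :=
  exists2 d : nat, (d <= n)%N & forall p, M p ->
    exists (W W' : set 'rV[R]_n) (phi psi : 'rV[R]_n -> 'rV[R]_n),
      [/\ [/\ open W, W p & open W'],
          smooth_on W phi /\ smooth_on W' psi,
          forall x, W x -> W' (phi x) /\ psi (phi x) = x,
          forall y, W' y -> W (psi y) /\ phi (psi y) = y
        & forall x, W x ->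
            (M x <-> forall i : 'I_n, (d <= i)%N -> phi x 0 i = 0)].

(* Velocities at p of curves in M. *)
Definition tangent_vector M (p v : 'rV[R]_n) : Prop :=
  exists gamma : R -> 'rV[R]_n,
    [/\ gamma 0 = p, forall t, M (gamma t) & is_derive (0 : R) 1 gamma v].

Definition vector_field_on M f : Prop :=
  forall x, M x -> tangent_vector M x (f x).

(* Solutions are in forward time; at t = 0 the equation holds for the one-sided
   derivative, by continuity of f on M. *)
Definition global_solution M f (gamma : R -> 'rV[R]_n) : Prop :=
  [/\ forall t : R, 0 <= t -> M (gamma t),
      {within `[0, +oo[, continuous gamma}
    & forall t : R, 0 < t -> is_derive t 1 gamma (f (gamma t))].

Definition solutions_exist_globally M f : Prop :=
  forall x0, M x0 -> exists2 gamma, gamma 0 = x0 & global_solution M f gamma.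

Definition first_integral M f (g : 'rV[R]_n -> R) : Prop :=
  forall gamma, global_solution M f gamma ->
    forall t : R, 0 <= t -> g (gamma t) = g (gamma 0).

End DynamicalSystem.

Section Integrator.
Context {R : realType} {n : nat}.
Implicit Types (U M : set 'rV[R]_n) (V : 'rV[R]_n -> R).

Definition level_set U M l (F : 'I_l -> 'rV[R]_n -> R) (xI : 'rV[R]_n) :
    set 'rV[R]_n :=
  [set x | [/\ U x, M x & forall j, F j x = F j xI]].

(* V^-1([0, e]) for V with domain U. *)
Definition sublevel U V (e : R) : set 'rV[R]_n := U `&` V @^-1` `[0, e].

Definition step_size V (c Hmin : R) (x : 'rV[R]_n) : R :=
  (c * Num.max (mx2norm (hess V x)) Hmin)^-1.

Definition feedback_step V (f : 'rV[R]_n -> 'rV[R]_n) (c Hmin h : R)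
    (x : 'rV[R]_n) : 'rV[R]_n :=
  x + h *: f x - step_size V c Hmin x *: grad V x.

End Integrator.

(* Main.v *)
(* The gradient vanishes on V = 0, so by compactness it is uniformly small on a
   thin sublevel set {V <= eps'}, and there the whole step d = h f - beta grad V
   is small.  A second order expansion along d, in which A1 makes f and grad V
   orthogonal, gives
     V (x + d) <= V x - kappa |grad V x|^2 + C h^2   with kappa > 0 as c > 1.
   Where V <= eps'/2 the gain C h^2 <= eps'/2 is harmless; where V > eps'/2 the
   gradient is bounded below by A3 and compactness, so that V decreases.  Hence
   {V <= eps'} is invariant. *)
Require Import Defs.
From mathcomp Require Import all_boot all_order all_algebra.
From mathcomp Require Import all_classical all_reals all_analysis.
From mathcomp Require Import ring lra.
Import Order.TTheory GRing.Theory Num.Theory.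
Import numFieldNormedType.Exports.
Local Open Scope classical_set_scope.
Local Open Scope ring_scope.

(** * Euclidean inner product and spectral norm *)

Section DotProduct.
Context {R : realType} {n : nat}.
Implicit Types (u v w : 'rV[R]_n) (A B : 'M[R]_n) (a b : R).

Lemma dotvC u v : dotv u v = dotv v u.
Proof. by apply: eq_bigr => i _; rewrite mulrC. Qed.

Lemma dotvDl u v w : dotv (u + v) w = dotv u w + dotv v w.
Proof. by rewrite /dotv -big_split; apply: eq_bigr => i _; rewrite !mxE mulrDl. Qed.

Lemma dotvZl a u v : dotv (a *: u) v = a * dotv u v.
Proof. by rewrite /dotv mulr_sumr; apply: eq_bigr => i _; rewrite !mxE mulrA. Qed.

Lemma dotvNl u v : dotv (- u) v = - dotv u v.
Proof. by rewrite -scaleN1r dotvZl mulN1r. Qed.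

Lemma dotvBl u v w : dotv (u - v) w = dotv u w - dotv v w.
Proof. by rewrite dotvDl dotvNl. Qed.

Lemma dotvv_ge0 u : 0 <= dotv u u.
Proof. by apply: sumr_ge0 => i _; rewrite -expr2 sqr_ge0. Qed.

Lemma ler_sqr_dotvv u i : u 0 i ^+ 2 <= dotv u u.
Proof.
rewrite /dotv (bigD1 i) //= expr2 lerDl.
by apply: sumr_ge0 => j _; rewrite -expr2 sqr_ge0.
Qed.

Lemma dotvv_eq0 u : dotv u u = 0 -> u = 0.
Proof.
move=> u0; apply/rowP => i; rewrite mxE; apply/eqP; rewrite -sqrf_eq0.
by rewrite eq_le sqr_ge0 andbT -u0 ler_sqr_dotvv.
Qed.

Lemma dotv0l u : dotv 0 u = 0.
Proof. by rewrite -(scale0r 0) dotvZl mul0r. Qed.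

Lemma enorm_ge0 u : 0 <= enorm u.
Proof. exact: sqrtr_ge0. Qed.

Lemma sqr_enorm u : enorm u ^+ 2 = dotv u u.
Proof. by rewrite sqr_sqrtr // dotvv_ge0. Qed.

Lemma enorm_eq0 u : enorm u = 0 -> u = 0.
Proof. by move=> u0; apply: dotvv_eq0; rewrite -sqr_enorm u0 expr0n. Qed.

Lemma enorm_le u a : 0 <= a -> (enorm u <= a) = (dotv u u <= a ^+ 2).
Proof. by move=> a0; rewrite -sqr_enorm ler_sqr ?nnegrE ?enorm_ge0. Qed.

Lemma enormZ a u : enorm (a *: u) = `|a| * enorm u.
Proof.
by rewrite /enorm dotvZl dotvC dotvZl mulrA -expr2 sqrtrM ?sqr_ge0 // sqrtr_sqr.
Qed.

Lemma normr_le_enorm u i : `|u 0 i| <= enorm u.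
Proof. by rewrite -[leLHS]sqrtr_sqr ler_sqrt ?dotvv_ge0 // ler_sqr_dotvv. Qed.

(** Cauchy-Schwarz: expand the square of the Euclidean norm of [enorm v *: u - enorm u *: v], which
    is nonnegative, and divide by [enorm u * enorm v]. The zero vectors are treated apart. *)
Lemma dotv_le_enorm u v : dotv u v <= enorm u * enorm v.
Proof.
have [/eqP u0|u0] := boolP (enorm u == 0).
  by rewrite (enorm_eq0 _ u0) dotv0l mulr_ge0 ?enorm_ge0.
have [/eqP v0|v0] := boolP (enorm v == 0).
  by rewrite (enorm_eq0 _ v0) dotvC dotv0l mulr_ge0 ?enorm_ge0.
have uv0 : 0 < enorm u * enorm v.
  by rewrite mulr_gt0 // lt0r ?u0 ?v0 enorm_ge0.
have := dotvv_ge0 (enorm v *: u - enorm u *: v).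
rewrite dotvBl !dotvZl ![dotv _ (_ - _)]dotvC !dotvBl !dotvZl -!sqr_enorm.
rewrite (dotvC v u) => w0.
rewrite -(ler_pM2l uv0); nra.
Qed.

(** A crude majorant of [mx2norm] whose continuity along [hess V] is immediate; it serves to bound
    the Hessian on a compact set. *)
Definition mxsum A : R := \sum_i \sum_j `|A i j|.

Lemma enorm_le_sum u : enorm u <= \sum_i `|u 0 i|.
Proof.
rewrite enorm_le; last exact: sumr_ge0.
rewrite expr2 mulr_suml; apply: ler_sum => i _.
rewrite (le_trans (ler_norm _)) // normrM ler_wpM2l //.
by rewrite (bigD1 i) //= lerDl sumr_ge0.
Qed.

Lemma enorm_mulmx_le A u : enorm u <= 1 -> enorm (u *m A^T) <= mxsum A.
Proof.
move=> u1; rewrite (le_trans (enorm_le_sum _)) //; apply: ler_sum => i _.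
rewrite mxE (le_trans (ler_norm_sum _ _ _)) //; apply: ler_sum => j _.
by rewrite normrM mxE ler_piMl // (le_trans (normr_le_enorm _ _)).
Qed.

(** Without this, the [sup] that defines [mx2norm] could be a default value. *)
Lemma mx2norm_has_sup A :
  has_sup [set enorm (u *m A^T) | u in [set u | enorm u <= 1]].
Proof.
split.
  exists (enorm (0 *m A^T)), 0 => //=.
  by rewrite /enorm dotv0l sqrtr0.
by exists (mxsum A) => _ [u /= u1 <-]; apply: enorm_mulmx_le.
Qed.

Lemma mx2norm_le_sum A : mx2norm A <= mxsum A.
Proof.
apply: ge_sup; first exact: (mx2norm_has_sup A).1.
by move=> _ [u /= u1 <-]; apply: enorm_mulmx_le.
Qed.

Lemma enorm_mulmx A u : enorm (u *m A^T) <= mx2norm A * enorm u.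
Proof.
have [/eqP u0|u0] := boolP (enorm u == 0).
  by rewrite u0 mulr0 (enorm_eq0 _ u0) mul0mx /enorm dotv0l sqrtr0.
have up : 0 < enorm u by rewrite lt0r u0 enorm_ge0.
rewrite -ler_pdivrMr // mulrC -[X in X * _]ger0_norm ?invr_ge0 ?enorm_ge0 //.
rewrite -enormZ scalemxAl; apply: sup_upper_bound; first exact: mx2norm_has_sup.
exists ((enorm u)^-1 *: u) => //=.
by rewrite enormZ ger0_norm ?invr_ge0 ?enorm_ge0 // mulVf.
Qed.

Lemma quadratic_le_mx2norm A u : dotv u (u *m A^T) <= mx2norm A * dotv u u.
Proof.
rewrite (le_trans (dotv_le_enorm _ _)) // -sqr_enorm expr2 mulrA mulrC.
by rewrite ler_wpM2r ?enorm_ge0 // enorm_mulmx.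
Qed.

End DotProduct.

(** * Uniform bounds from compactness *)

Section Compactness.
Context {R : realType} {T : topologicalType}.
Implicit Types (K : set T) (a b : T -> R).

(** Each point has a threshold that is valid on a whole neighbourhood; finitely many such
    neighbourhoods cover [K], so one positive [e] serves all of them. *)
Lemma compact_near_right K (P : R -> T -> Prop) : compact K ->
  (forall x, K x -> exists2 r : R, 0 < r &
    \forall y \near x, forall e, 0 < e -> e < r -> P e y) ->
  exists2 e : R, 0 < e & forall x, K x -> P e x.
Proof.
move=> /compact_near_coveringP cK KP.
have nearP : \forall e \near (0 : R)^'+, K `<=` P e.
  apply: cK => x /KP[r r0 Pr].
  exists ([set y | forall e, 0 < e -> e < r -> P e y], [set e | 0 < e /\ e < r]).
    split=> //; apply: filterI; [exact: nbhs_right_gt | exact: nbhs_right_lt].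
  by move=> [y e] /= [Py [e0 er]]; exact: Py.
have [e [e0 Pe]] : exists e : R, 0 < e /\ K `<=` P e.
  apply: (@filter_ex _ (0 : R)^'+); near=> e; split => //.
  by near: e; exact: nearP.
by exists e.
Unshelve. all: by end_near.
Qed.

(** Near a zero of [a], continuity keeps [b] below [dlt]; near any other point [a] stays above half
    its value, so [a y < e] fails for small [e]. It is applied twice, with [V] and the squared
    gradient in exchanged roles. *)
Lemma compact_small_of_zero K a b (dlt : R) : compact K ->
  (forall x, K x -> {for x, continuous a}) ->
  (forall x, K x -> {for x, continuous b}) ->
  (forall x, K x -> 0 <= a x) ->
  (forall x, K x -> a x = 0 -> b x < dlt) ->
  exists2 e : R, 0 < e & forall x, K x -> a x < e -> b x < dlt.
Proof.
move=> cK ca cb a0 ab.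
apply: (@compact_near_right _ (fun e x => a x < e -> b x < dlt)) => // x Kx.
have [ax0|ax0] := eqVneq (a x) 0.
  exists 1 => //; near=> y => e _ _ _; near: y.
  by apply: cvgr_lt (cb x Kx) _ (ab x Kx ax0).
have ax : 0 < a x by rewrite lt0r ax0 a0.
exists (a x / 2); first by rewrite divr_gt0.
near=> y => e _ ea aye; exfalso.
have : a x / 2 < a y.
  by near: y; apply: cvgr_gt (ca x Kx) _ _; rewrite gtr_pMr ?invf_lt1 ?ltr1n.
by move=> /lt_trans/(_ aye)/lt_trans/(_ ea); rewrite ltxx.
Unshelve. all: by end_near.
Qed.

Lemma compact_bounded_above K b : compact K ->
  (forall x, K x -> {for x, continuous b}) ->
  exists2 B : R, 0 < B & forall x, K x -> b x < B.
Proof.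
move=> cK cb.
(* The inverse of the small parameter plays the part of the bound. *)
have [||e e0 eb] := @compact_near_right K (fun e x => b x < e^-1) => //.
  move=> x Kx; have bx0 : 0 < `|b x| + 1 by rewrite ltr_wpDl.
  exists (`|b x| + 1)^-1; first by rewrite invr_gt0.
  near=> y => e e0 eb; apply: (@lt_trans _ _ (`|b x| + 1)).
    near: y; apply: cvgr_lt (cb x Kx) _ _.
    by rewrite (le_lt_trans (ler_norm _)) // ltrDl.
  by rewrite -[ltLHS]invrK ltf_pV2 // posrE ?invr_gt0.
by exists e^-1 => //; rewrite invr_gt0.
Unshelve. all: by end_near.
Qed.

End Compactness.

(** * Expansion along a segment and critical points *)

Section Taylor.
Context {R : realType} {n : nat}.
Implicit Types (V : 'rV[R]_n -> R) (x d : 'rV[R]_n).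

Lemma derive_dotv V x d : differentiable V x -> 'D_d V x = dotv (grad V x) d.
Proof.
move=> dV; rewrite deriveE // [in LHS](row_sum_delta d) linear_sum.
by apply: eq_bigr => i _; rewrite linearZ mxE mulrC /= deriveE.
Qed.

Lemma is_derive_line V x d (t : R) : differentiable V (x + t *: d) ->
  is_derive t 1 (fun s => V (x + s *: d)) (dotv (grad V (x + t *: d)) d).
Proof.
move=> dV.
have dl : is_diff t (cst x + (fun s : R => s *: d)) (0 + (fun s : R => s *: d)).
  exact: is_diffD.
have dc : differentiable (V \o (cst x + (fun s : R => s *: d))) t.
  apply: differentiable_comp => //.
split; first exact: diff_derivable.
rewrite deriveE // diff_comp //= diff_val /=.
rewrite -derive_dotv // deriveE //; congr ('d V _ _).
by rewrite -[LHS]/(0 + 1 *: d) add0r scale1r.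
Qed.

(** The degenerate case [a = b] is included because the second use below runs on [[0, c]], where [c]
    may be 0. *)
Lemma MVT_closed (g dg : R -> R) (a b : R) : a <= b ->
  (forall t, a <= t <= b -> is_derive t 1 g (dg t)) ->
  exists2 c, a <= c <= b & g b - g a = dg c * (b - a).
Proof.
move=> ab dgP.
have [||c] := @MVT_segment R g dg a b ab.
- by move=> t; rewrite in_itv /= => /andP[/ltW ta /ltW tb]; apply: dgP; rewrite ta.
- apply: derivable_within_continuous => t; rewrite in_itv /= => tab.
  by case: (dgP t tab).
by rewrite in_itv /= => cab e; exists c.
Qed.

(** Two mean value steps: on [[0, 1]] for [V], then on [[0, c]] for its derivative along [d]. The
    remainder is the Hessian form at an intermediate point times [c <= 1], which gives the constant
    [B] rather than [B / 2]. *)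
Lemma taylor2_le V x d (B : R) : 0 <= B ->
  (forall t, 0 <= t <= 1 -> differentiable V (x + t *: d)) ->
  (forall i t, 0 <= t <= 1 -> differentiable (partials [:: i] V) (x + t *: d)) ->
  (forall t, 0 <= t <= 1 ->
     dotv d (d *m (hess V (x + t *: d))^T) <= B * dotv d d) ->
  V (x + d) <= V x + dotv (grad V x) d + B * dotv d d.
Proof.
move=> B0 dV ddV HB.
have [c /andP[c0 c1]] := @MVT_closed _ _ 0 1 ler01
  (fun t t01 => is_derive_line _ _ _ _ (dV t t01)).
rewrite scale1r scale0r addr0 subr0 mulr1 => e1.
pose psi s := dotv (grad V (x + s *: d)) d.
pose dpsi s := dotv d (d *m (hess V (x + s *: d))^T).
have dpsiP t : 0 <= t <= c -> is_derive t 1 psi (dpsi t).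
  move=> /andP[t0 tc].
  have -> : psi = \sum_i (d 0 i \*: (fun s => partials [:: i] V (x + s *: d))).
    apply/funext => s; rewrite fct_sumE; apply: eq_bigr => i _.
    by rewrite mxE mulrC.
  have -> : dpsi t = \sum_i d 0 i *: dotv (grad (partials [:: i] V) (x + t *: d)) d.
    (* Exchanging the sums groups the Hessian by columns: column [k] is the gradient of the [k]-th
       partial derivative. *)
    rewrite /dpsi /dotv; under eq_bigr do rewrite mxE mulr_sumr.
    rewrite exchange_big /=; apply: eq_bigr => k _.
    rewrite -[RHS]/(d 0 k * _) mulr_sumr; apply: eq_bigr => i _.
    by rewrite !mxE mulrC -mulrA.
  apply: is_derive_sum => i; apply: is_deriveZ; apply: is_derive_line.
  by apply: ddV; rewrite t0 (le_trans tc).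
have [s /andP[s0 sc]] := MVT_closed _ _ _ _ c0 dpsiP.
rewrite /psi scale0r addr0 subr0 => e2.
have := HB s; rewrite s0 (le_trans sc c1) => /(_ isT).
rewrite -/(dpsi s) => e3.
have e4 : dpsi s * c <= B * dotv d d.
  rewrite (le_trans (ler_wpM2r c0 e3)) // ler_piMr //.
  by rewrite mulr_ge0 ?dotvv_ge0.
lra.
Qed.

(** Fermat's rule on each coordinate line through [x], restricted to a short interval that stays in
    [U]. *)
Lemma grad_eq0_at_min (U : set 'rV[R]_n) V x : open U -> U x ->
  (forall y, U y -> differentiable V y) -> (forall y, U y -> V x <= V y) ->
  grad V x = 0.
Proof.
move=> oU Ux dV Vmin; apply/rowP => i; rewrite !mxE /=.
pose d : 'rV[R]_n := delta_mx 0 i.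
have [r r0 Ur] : exists2 r : R, 0 < r & forall t : R, `|t| < r -> U (x + t *: d).
  have : \forall t \near (0 : R), U (x + t *: d).
    have cl : {for 0, continuous (fun t : R => x + t *: d)}.
      by apply: cvgD; [exact: cvg_cst|apply: scalel_continuous].
    by apply: cl; rewrite scale0r addr0; exact: open_nbhs_nbhs.
  move=> /nbhs_ballP[r /= r0 rU]; exists r => // t tr; apply: rU.
  by rewrite /ball /= sub0r normrN.
have lineP (t : R) : `|t| < r -> is_derive t 1 (fun s : R => V (x + s *: d))
    (dotv (grad V (x + t *: d)) d).
  by move=> tr; apply: is_derive_line; exact/dV/Ur.
have der0 : is_derive (0 : R) 1 (fun s : R => V (x + s *: d)) 0.
  apply: (@derive1_at_min _ _ (- r) r).
  - by rewrite ge0_cp // ltW.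
  - by move=> t; rewrite in_itv /= -ltr_norml => /lineP[].
  - by rewrite in_itv /= oppr_lt0 r0.
  - move=> t; rewrite in_itv /= -ltr_norml => /Ur Ut.
    by rewrite scale0r addr0; exact: Vmin.
have := lineP 0; rewrite normr0 => /(_ r0)[_].
by rewrite derive_val scale0r addr0 -derive_dotv; [move=> <-|exact: dV].
Qed.

End Taylor.

(** * Continuity of finite sums *)

Section ContinuitySums.
Context {R : realType} {T : topologicalType}.

Lemma continuous_sumr (I : finType) (x : T) (g : I -> T -> R) :
  (forall i, {for x, continuous (g i)}) ->
  {for x, continuous (fun y => \sum_i g i y)}.
Proof.
move=> gc; suff : {for x, continuous (\sum_i g i)}.
  by congr (_ : Prop); rewrite fct_sumE.
elim/big_ind: _ => [|a b ca cb|i _]; [exact: cvg_cst|exact: cvgD|exact: gc].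
Qed.

End ContinuitySums.

(** * Energy estimate for one step *)

Section Descent.
Context {R : realType} {n : nat}.
Implicit Types (U : set 'rV[R]_n) (V : 'rV[R]_n -> R) (x d : 'rV[R]_n).

(** Along the segment the Hessian differs from its value at [x] by at most
    [(c - 1) / 2 * Hmin <= (c - 1) / 2 * L], so its quadratic form is at most [L * ((c + 1) / 2)]
    times the squared length. Orthogonality of [f x] and the gradient removes the cross terms. *)
Lemma feedback_step_le U V (f : 'rV[R]_n -> 'rV[R]_n) (Gamma c Hmin h : R) x :
  let L := Num.max (mx2norm (hess V x)) Hmin in
  let d := h *: f x - step_size V c Hmin x *: grad V x in
  smooth_on U V -> dotv (grad V x) (f x) = 0 -> 1 < c -> 0 < Hmin ->
  (forall t : R, 0 <= t <= 1 -> U (x + t *: d)) ->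
  (forall t : R, 0 <= t <= 1 ->
    mx2norm (hess V (x + t *: d) - hess V x) <= Gamma * enorm (t *: d)) ->
  `|Gamma| * enorm d <= (c - 1) / 2 * Hmin ->
  V (feedback_step V f c Hmin h x) <=
    V x - step_size V c Hmin x * ((c - 1) / (2 * c)) * dotv (grad V x) (grad V x)
    + L * ((c + 1) / 2) * (h ^+ 2 * dotv (f x) (f x)).
Proof.
set b := step_size _ _ _ _; set g := grad V x; move=> L d sV gf c1 H0 Ud Lip small.
have HL : Hmin <= L by rewrite le_max lexx orbT.
have L0 : 0 < L := lt_le_trans H0 HL.
have bL : b * L = c^-1.
  by rewrite /b /step_size -/L invfM -mulrA mulVf ?mulr1 // gt_eqF.
have c0 : 0 < c := lt_trans ltr01 c1.
have dd : dotv d d = h ^+ 2 * dotv (f x) (f x) + b ^+ 2 * dotv g g.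
  rewrite /d -/g -/b dotvBl !dotvZl ![dotv _ (_ - _)]dotvC !dotvBl !dotvZl gf.
  rewrite (dotvC (f x)) gf; ring.
have gd : dotv g d = - (b * dotv g g).
  by rewrite /d -/g -/b dotvC dotvBl !dotvZl dotvC gf mulr0 sub0r.
have dotvDr u v w : dotv u (v + w) = dotv u v + dotv u w :> R.
  by rewrite dotvC dotvDl !(dotvC u).
have step : V (x + d) <= V x + dotv g d + L * ((c + 1) / 2) * dotv d d.
  apply: taylor2_le.
  - by rewrite !mulr_ge0 ?invr_ge0 ?addr_ge0 // ltW.
  - by move=> t t01; apply: (sV [::]); exact: Ud.
  - by move=> i t t01; apply: (sV [:: i]); exact: Ud.
  move=> t t01; rewrite -[hess V (x + t *: d)](subrK (hess V x)).
  rewrite linearD mulmxDr dotvDr.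
  have q1 := quadratic_le_mx2norm (hess V (x + t *: d) - hess V x) d.
  have q2 := quadratic_le_mx2norm (hess V x) d.
  rewrite (le_trans (lerD q1 q2)) // -mulrDl ler_wpM2r ?dotvv_ge0 //.
  have l1 : mx2norm (hess V x) <= L by rewrite le_max lexx.
  have l2 : mx2norm (hess V (x + t *: d) - hess V x) <= (c - 1) / 2 * Hmin.
    rewrite (le_trans (Lip t t01)) // (le_trans _ small) // enormZ.
    rewrite (le_trans (ler_norm _)) // !normrM normr_id ler_wpM2l //.
    rewrite (ger0_norm (enorm_ge0 _)) ler_piMl ?enorm_ge0 //.
    by case/andP: t01 => t0 t1; rewrite ger0_norm.
  have l3 : (c - 1) / 2 * Hmin <= (c - 1) / 2 * L.
    by rewrite ler_wpM2l // divr_ge0 // subr_ge0 ltW.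
  lra.
rewrite /feedback_step -addrA -/b -/g -/d (le_trans step) // gd dd.
(* Both sides agree: with [b * L = c^-1] the coefficient of the squared gradient is [- b + b * (c +
   1) / (2 * c) = - b * ((c - 1) / (2 * c))]. *)
rewrite le_eqVlt; apply/orP; left; apply/eqP.
have -> : L * ((c + 1) / 2) * (h ^+ 2 * dotv (f x) (f x) + b ^+ 2 * dotv g g) =
  L * ((c + 1) / 2) * (h ^+ 2 * dotv (f x) (f x))
  + (b * L) * b * ((c + 1) / 2) * dotv g g by ring.
rewrite bL; field; exact: lt0r_neq0.
Qed.

(** Transfers Euclidean smallness to the balls of the library, which are those of the sup norm. *)
Lemma norm_le_enorm (u : 'rV[R]_n) : `|u| <= enorm u.
Proof.
rewrite -[`|u|]/(mx_norm u) mx_normrE; apply/bigmax_leP; split; first exact: enorm_ge0.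
by move=> [i j] _ /=; rewrite ord1; exact: normr_le_enorm.
Qed.

End Descent.

(** * Room around a sublevel set, and continuity of derivatives *)

Section SublevelSets.
Context {R : realType} {n : nat}.
Implicit Types (U K : set 'rV[R]_n) (V : 'rV[R]_n -> R) (x d : 'rV[R]_n).

(** Around a point with [V x <= eps] some ball lies in [U] and in [V < nu]; half its radius is spent
    on moving the point, half on [d]. Points with [V x > eps] have neighbourhoods where the premise
    fails. Compactness makes the radius uniform. *)
Lemma sublevel_thicken U V (nu eps : R) : open U ->
  (forall x, U x -> {for x, continuous V}) -> compact (sublevel U V nu) ->
  eps < nu ->
  exists2 r : R, 0 < r & forall x d, sublevel U V nu x -> V x <= eps ->
    enorm d <= r -> U (x + d) /\ V (x + d) < nu.
Proof.
move=> oU cV cK epsnu.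
have [|r r0 rP] := @compact_near_right _ _ _ (fun e x => V x <= eps ->
   forall d, enorm d <= e -> U (x + d) /\ V (x + d) < nu) cK; last first.
  by exists r => // x d Kx Vx dr; exact: rP.
move=> x [Ux _]; have [Vx|Vx] := leP (V x) eps; last first.
  exists 1 => //; near=> y => e _ _ Vy; exfalso; move: Vy; apply/negP; rewrite -ltNge.
  by near: y; apply: cvgr_gt (cV x Ux) _ Vx.
have : \forall y \near x, U y /\ V y < nu.
  apply: filterI; first exact: open_nbhs_nbhs.
  by apply: cvgr_lt (cV x Ux) _ (le_lt_trans Vx epsnu).
move=> /nbhs_ballP[s /= s0 sP]; exists (s / 2); first by rewrite divr_gt0.
near=> y => e _ es _ d de; apply: sP.
rewrite -ball_normE /= opprD addrA (le_lt_trans (ler_normB _ _)) //.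
rewrite [ltRHS]splitr ltrD //; last first.
  by rewrite (le_lt_trans (norm_le_enorm _)) // (le_lt_trans de).
near: y; have := nbhsx_ballx x (s / 2); rewrite divr_gt0 // => /(_ isT).
by rewrite -ball_normE.
Unshelve. all: by end_near.
Qed.

Lemma continuous_dotv (F G : 'rV[R]_n -> 'rV[R]_n) x :
  (forall i, {for x, continuous (fun y => F y 0 i)}) ->
  (forall i, {for x, continuous (fun y => G y 0 i)}) ->
  {for x, continuous (fun y => dotv (F y) (G y))}.
Proof. by move=> cF cG; apply: continuous_sumr => i; apply: continuousM; [exact: cF|exact: cG]. Qed.

Lemma continuous_grad U V x i : smooth_on U V -> U x ->
  {for x, continuous (fun y => grad V y 0 i)}.
Proof.
move=> sV Ux; rewrite (_ : (fun y => _) = partials [:: i] V).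
  exact/differentiable_continuous/sV.
by apply/funext => y; rewrite mxE.
Qed.

Lemma continuous_mxsum_hess U V x : smooth_on U V -> U x ->
  {for x, continuous (fun y => mxsum (hess V y))}.
Proof.
move=> sV Ux; apply: continuous_sumr => i; apply: continuous_sumr => j.
rewrite (_ : (fun y => _) = (fun y => `|partials [:: i; j] V y|)).
  exact: cvg_norm (differentiable_continuous (sV [:: i; j] x Ux)).
by apply/funext => y; rewrite mxE.
Qed.

End SublevelSets.

(** * Choice of the constants and induction on the iterates *)

Theorem theorem4 (R : realType) (n l : nat) (M U : set 'rV[R]_n)
    (f : 'rV[R]_n -> 'rV[R]_n) (F : 'I_l -> 'rV[R]_n -> R) (xI : 'rV[R]_n)
    (V : 'rV[R]_n -> R) (nu Gamma : R)
    (hM : embedded_manifold M)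
    (hUopen : open U) (hMU : M `<=` U)
    (hfU : smooth_on U f) (hFU : forall j : 'I_l, smooth_on U (F j))
    (hfM : vector_field_on M f)
    (hglobal : solutions_exist_globally M f)
    (hF : forall j : 'I_l, first_integral M f (F j))
    (hxI : M xI)
    (hVanalytic : analytic_on U V)
    (hVge0 : forall x : 'rV[R]_n, U x -> 0 <= V x)
    (hVzero : U `&` V @^-1` [set 0] = level_set U M F xI)
    (A1 : forall x : 'rV[R]_n, U x -> dotv (grad V x) (f x) = 0)
    (hnu : 0 < nu)
    (A2 : compact (sublevel U V nu))
    (A3 : forall x : 'rV[R]_n, sublevel U V nu x -> grad V x = 0 -> V x = 0)
    (hLip : forall x y : 'rV[R]_n, sublevel U V nu x -> sublevel U V nu y ->
      mx2norm (hess V x - hess V y) <= Gamma * enorm (x - y)) :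
  forall c Hmin eps : R, 1 < c -> 0 < Hmin -> 0 < eps -> eps < nu ->
  exists2 h0 : R, 0 < h0 &
    forall h : R, 0 < h -> h < h0 ->
    forall x : nat -> 'rV[R]_n, x 0%N = xI ->
      (forall k : nat, x k.+1 = feedback_step V f c Hmin h (x k)) ->
    forall k : nat, U (x k) /\ V (x k) <= eps.
Proof.
move=> c Hmin eps c1 Hmin0 eps0 epsnu.
have sV : smooth_on U V := hVanalytic.1.
have dV x : U x -> differentiable V x by exact: (sV [::]).
have cV x : U x -> {for x, continuous V}.
  by move=> /dV; exact: differentiable_continuous.
pose K := sublevel U V nu.
have KU x : K x -> U x by case.
have KI x : U x -> V x <= nu -> K x.
  by move=> Ux Vx; split=> //=; rewrite in_itv /= hVge0.
pose q x := dotv (grad V x) (grad V x).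
have cq x : K x -> {for x, continuous q}.
  by move=> /KU Ux; apply: continuous_dotv => i; exact: continuous_grad sV Ux.
have qV0 x : U x -> V x = 0 -> grad V x = 0.
  move=> Ux Vx0; apply: (grad_eq0_at_min U) => // y Uy.
  by rewrite Vx0 hVge0.
have [Fb Fb0 fFb] : exists2 B : R, 0 < B &
    forall x, K x -> dotv (f x) (f x) < B.
  apply: compact_bounded_above => // x /KU Ux.
  have cfi i : {for x, continuous (fun y => f y 0 i)}.
    apply: (@continuous_comp _ _ _ f (fun v : 'rV[R]_n => v 0 i)).
      exact: (differentiable_continuous (hfU [::] x Ux)).
    exact: coord_continuous.
  exact: continuous_dotv.
have [Sb Sb0 HSb] : exists2 B : R, 0 < B &
    forall x, K x -> mxsum (hess V x) < B.
  by apply: compact_bounded_above => // x /KU; exact: continuous_mxsum_hess.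
have [r r0 rP] := sublevel_thicken U V nu eps hUopen cV A2 epsnu.
pose s := (c - 1) / 2 * Hmin.
have s0 : 0 < s by rewrite mulr_gt0 // divr_gt0 // subr_gt0.
(* Steps of length at most [rho] keep the segment in [K] and the Hessian variation within [s].
   Adding 1 avoids a division by zero, and the absolute value covers any sign of [Gamma]. *)
pose rho := Num.min r (s / (`|Gamma| + 1)).
have G0 : 0 < `|Gamma| + 1 by rewrite ltr_wpDl.
have rho0 : 0 < rho by rewrite lt_min r0 divr_gt0.
have rhor : rho <= r by rewrite ge_min lexx.
have rhos : `|Gamma| * rho <= s.
  have : rho <= s / (`|Gamma| + 1) by rewrite ge_min lexx orbT.
  rewrite ler_pdivlMr // mulrDr mulr1 mulrC; apply: le_trans.
  by rewrite lerDl ltW.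
(* Since [b <= Hmin^-1], the bound [q y < dlt] gives the gradient part of [d] a squared length of at
   most [rho ^+ 2 / 2]; the other half is left to [h *: f y]. *)
pose dlt := rho ^+ 2 / 2 * Hmin ^+ 2.
have dlt0 : 0 < dlt by rewrite mulr_gt0 ?divr_gt0 ?exprn_gt0.
have [e e0 eP] : exists2 e : R, 0 < e & forall x, K x -> V x < e -> q x < dlt.
  apply: compact_small_of_zero => //.
  - by move=> x /KU /cV.
  - by move=> x /KU /hVge0.
  - by move=> x /KU Ux Vx0; rewrite /q qV0 // dotv0l.
(* Halving [e] turns [V y <= eps'] into the strict [V y < e] that [eP] asks for. *)
pose eps' := Num.min eps (e / 2).
have eps'0 : 0 < eps' by rewrite lt_min eps0 divr_gt0.
have eps'eps : eps' <= eps by rewrite ge_min lexx.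
have eps'e : eps' < e.
  by rewrite gt_min ltr_pdivrMr // ltr_pMr // ltr1n orbT.
(* Used through its contrapositive: where [V] is at least [eps' / 2], the squared gradient is at
   least [m]. A3 enters here. *)
have [m m0 mP] : exists2 m : R, 0 < m &
    forall x, K x -> q x < m -> V x < eps' / 2.
  apply: compact_small_of_zero => //.
  - by move=> x /KU /cV.
  - by move=> x _; exact: dotvv_ge0.
  - by move=> x Kx /dotvv_eq0 /(A3 x Kx) ->; rewrite divr_gt0.
pose Lmax := Hmin + Sb.
have Lmax0 : 0 < Lmax by rewrite addr_gt0.
have c0 : 0 < c := lt_trans ltr01 c1.
(* [C] and [kap] are the worst cases over [K] of the growth and decay coefficients in
   [feedback_step_le]. *)
pose C := Lmax * ((c + 1) / 2) * Fb.
have C0 : 0 < C by rewrite !mulr_gt0 // ?invr_gt0 // addr_gt0.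
pose kap := (c * Lmax)^-1 * ((c - 1) / (2 * c)).
have kap0 : 0 < kap.
  by rewrite mulr_gt0 ?invr_gt0 ?divr_gt0 ?subr_gt0 ?mulr_gt0.
(* Three demands on [h ^+ 2]: step length at most [rho], growth at most [eps' / 2], and growth at
   most the guaranteed decay [kap * m]. *)
pose B := Num.min (rho ^+ 2 / 2) (Num.min (eps' / 2) (kap * m)).
have ltr0n2 : 0 < 2 :> R by rewrite ltr0n.
have B0 : 0 < B.
  rewrite 2!lt_min (mulr_gt0 kap0 m0) (divr_gt0 eps'0 ltr0n2).
  by rewrite (divr_gt0 (exprn_gt0 2 rho0) ltr0n2).
have A0 : 0 < Fb + C by rewrite addr_gt0.
(* The cap 1 gives [h ^+ 2 <= h], so a bound linear in [h] suffices. *)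
exists (Num.min 1 (B / (Fb + C))); first by rewrite lt_min ltr01 divr_gt0.
move=> h h0; rewrite lt_min ltr_pdivlMr // => /andP[h1 hB].
have h2B : h ^+ 2 * (Fb + C) <= B.
  have h2h : h ^+ 2 <= h by rewrite expr2 ler_piMr // ltW.
  by rewrite (le_trans _ (ltW hB)) // ler_wpM2r // ltW.
have {hB h1} [hB1 hB2 hB3] : [/\ h ^+ 2 * Fb <= rho ^+ 2 / 2,
    h ^+ 2 * C <= eps' / 2 & h ^+ 2 * C <= kap * m].
  have h20 := sqr_ge0 h.
  have p1 : 0 <= h ^+ 2 * Fb by rewrite mulr_ge0 // ltW.
  have p2 : 0 <= h ^+ 2 * C by rewrite mulr_ge0 // ltW.
  by move: h2B; rewrite mulrDr !le_min => /andP[? /andP[? ?]]; split; lra.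
move=> x x0 xS k.
(* The induction needs the thinner level [eps'], on which the gradient is known to be small. *)
suff [Ux Vx] : U (x k) /\ V (x k) <= eps' by split=> //; exact: le_trans eps'eps.
elim: k => [|k [Ux Vx]].
  have : level_set U M F xI xI by split=> //; exact: hMU.
  by rewrite -hVzero x0 => -[UI /= ->]; split=> //; exact: ltW.
rewrite xS; set y := x k in Ux Vx *.
have Ky : K y by apply: KI => //; lra.
pose L := Num.max (mx2norm (hess V y)) Hmin.
pose b := step_size V c Hmin y.
have HL : Hmin <= L by rewrite le_max lexx orbT.
have L0 : 0 < L := lt_le_trans Hmin0 HL.
have LLmax : L <= Lmax.
  rewrite ge_max; apply/andP; split; last by rewrite lerDl ltW.
  rewrite (le_trans (mx2norm_le_sum _)) // (le_trans (ltW (HSb y Ky))) //.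
  by rewrite lerDr ltW.
have b0 : 0 < b by rewrite invr_gt0 mulr_gt0.
have bH : b <= Hmin^-1.
  by rewrite lef_pV2 ?posrE ?mulr_gt0 // (le_trans HL) // ler_peMl // ltW.
have bL : (c * Lmax)^-1 <= b.
  by rewrite lef_pV2 ?posrE ?mulr_gt0 // ler_wpM2l // ltW.
pose d := h *: f y - b *: grad V y.
have dd : dotv d d = h ^+ 2 * dotv (f y) (f y) + b ^+ 2 * q y.
  rewrite /d dotvBl !dotvZl ![dotv _ (_ - _)]dotvC !dotvBl !dotvZl A1 //.
  rewrite (dotvC (f y)) A1 // /q; ring.
have fy := fFb y Ky.
have drho : enorm d <= rho.
  rewrite enorm_le ?(ltW rho0) // dd [leRHS]splitr lerD //.
    by rewrite (le_trans _ hB1) // ler_wpM2l ?sqr_ge0 // ltW.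
  have qy : q y < dlt by apply: eP => //; exact: le_lt_trans eps'e.
  apply: (@le_trans _ _ (Hmin^-1 ^+ 2 * dlt)).
    apply: ler_pM; [exact: sqr_ge0|exact: dotvv_ge0| |exact: ltW].
    have Hi0 : 0 <= Hmin^-1 by rewrite invr_ge0 ltW.
    by apply: lerXn2r => //; rewrite nnegrE // ltW.
  rewrite le_eqVlt; apply/orP; left; apply/eqP.
  rewrite /dlt; field; exact: lt0r_neq0.
(* The whole segment must stay in [K], since the Lipschitz bound on the Hessian holds only there. *)
have tdr (t : R) : 0 <= t <= 1 -> enorm (t *: d) <= r.
  move=> /andP[t0 t1]; rewrite enormZ ger0_norm //.
  by rewrite (le_trans _ (le_trans drho rhor)) // ler_piMl ?enorm_ge0.
have td (t : R) : 0 <= t <= 1 -> U (y + t *: d) /\ V (y + t *: d) < nu.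
  by move=> /tdr; apply: rP => //; exact: le_trans eps'eps.
have Ud : U (feedback_step V f c Hmin h y).
  rewrite /feedback_step -addrA -/b -/d -[d]scale1r.
  by apply: (td 1 _).1; rewrite ler01 lexx.
split=> //.
have := @feedback_step_le _ _ U V f Gamma c Hmin h y sV (A1 y Ux) c1 Hmin0.
rewrite -/b -/d -/L -/(q y) => /(_ _ _ _)/le_trans; apply.
- by move=> t /td[].
- move=> t /td[Ut Vt]; rewrite -[X in enorm X](addKr y) (addrC (- y)).
  by apply: hLip => //; apply: KI => //; exact: ltW.
- by rewrite (le_trans _ rhos) // ler_wpM2l.
have growth : L * ((c + 1) / 2) * (h ^+ 2 * dotv (f y) (f y)) <= h ^+ 2 * C.
  have c20 : 0 <= (c + 1) / 2 by rewrite divr_ge0 // addr_ge0 // ltW.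
  rewrite /C [leRHS]mulrCA; apply: ler_pM.
  - by apply: mulr_ge0 => //; exact: ltW.
  - by apply: mulr_ge0; [exact: sqr_ge0|exact: dotvv_ge0].
  - exact: ler_wpM2r.
  - by apply: ler_wpM2l; [exact: sqr_ge0|exact: ltW].
have q0 : 0 <= q y := dotvv_ge0 _.
have w0 : 0 <= (c - 1) / (2 * c) by rewrite divr_ge0 ?subr_ge0 ?mulr_ge0 // ltW.
have kq : kap * q y <= b * ((c - 1) / (2 * c)) * q y.
  by rewrite ler_wpM2r // ler_wpM2r.
(* With a small gradient, [V y < eps' / 2] leaves room for growth of [eps' / 2]; otherwise the decay
   is at least [kap * m] and outweighs the growth. *)
have [qm|mq] := ltP (q y) m.
  have := mP y Ky qm.
  have : 0 <= kap * q y by rewrite mulr_ge0 // ltW.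
  lra.
have : kap * m <= kap * q y by rewrite ler_wpM2l // ltW.
lra.
Qed.
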